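(* Let $(\mathcal{X},\rho,\nu)$ be a metric measure space with $\rho$ separable and $\nu$ a finite Borel measure. Let $c$ be a concept whose boundary $\partial\mathcal{X}$ satisfies $\nu(\partial\mathcal{X})=0$, and let the $\nu$-dominated adversary have smoothness rate $\epsilon$. Fix $p>0$. Then with probability at least $1-p$, the 1-nearest neighbor rule satisfies, simultaneously for all $T\in\mathbb{N}$, $$\#\mathrm{mistakes}_T\le\min\left\{T,\ \inf_{V\subset\mathcal{X}}\ \mathcal{N}_{\mathrm{ML}}(V)+T\,\epsilon\big(\nu(V^c)\big)+\sqrt{2T\log\frac{2T}{p}}\right\},$$ where the infimum is over measurable $V$.
   Context: Protocol: adversary fixes $c:\mathcal{X}\to\mathcal{Y}$; at each $t$ it picks a distribution $\mu_t$ (possibly history-dependent), draws $x_t\sim\mu_t$; the 1-nearest neighbor rule predicts $\hat y_t=c(x_{\mathrm{NN}_t})$ with $\mathrm{NN}_t\in\arg\min_{\tau<t}\rho(x_t,x_\tau)$ (ties arbitrary). $\#\mathrm{mistakes}_T=\sum_{t=1}^T\mathbb{1}\{\hat y_t\ne c(x_t)\}$. Margin $m_c(x)=\inf_{x':c(x')\neq c(x)}\rho(x,x')$; $\partial\mathcal{X}=\{x:m_c(x)=0\}$. A set $U$ is mutually-labeling if $\rho(x,x')<m_c(x)$ for all $x,x'\in U$; $\mathcal{N}_{\mathrm{ML}}(V)$ is the minimal number of mutually-labeling sets needed to cover $V$. An adversary has smoothness rate $\epsilon:\mathbb{R}_{\ge0}\to[0,1]$ if every distribution $\mu$ it can select satisfies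 $\mu(A)\le\epsilon(\nu(A))$ for all measurable $A$; it is $\nu$-dominated if moreover $\lim_{\delta\to0}\epsilon(\delta)=0$. *)

(* Defs.v *)
From HB Require Import structures.
From mathcomp Require Import all_boot all_order all_algebra.
From mathcomp Require Import all_classical all_reals all_analysis.
From mathcomp Require Import measurable_realfun lebesgue_measure.
Set Implicit Arguments. Unset Strict Implicit. Unset Printing Implicit Defensive.
Import Order.TTheory GRing.Theory Num.Theory.
Import numFieldNormedType.Exports.
Local Open Scope classical_set_scope.
Local Open Scope ring_scope.

Section Defs.
Variables (R : realType) (X Y : Type) (rho : X -> X -> R) (c : X -> Y).

Definition is_metric : Prop :=
  [/\ forall x y, 0 <= rho x y,
      forall x y, rho x y = 0 <-> x = y,
      forall x y, rho x y = rho y x &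
      forall x y z, rho x z <= rho x y + rho y z].

Definition rho_separable : Prop :=
  exists D : set X, countable D /\
    forall x (e : R), 0 < e -> exists2 y, D y & rho x y < e.

Definition rho_open (U : set X) : Prop :=
  forall x, U x -> exists2 r : R, 0 < r & [set y | rho x y < r] `<=` U.

(* margin m_c(x) = inf_{x' : c x' <> c x} rho(x, x')  (+oo if no such x') *)
Definition margin (x : X) : \bar R :=
  ereal_inf [set (rho x x')%:E | x' in [set x' | c x' <> c x]].

Definition boundary : set X := [set x | margin x = 0%E].

Definition mutually_labeling (U : set X) : Prop :=
  forall x x', U x -> U x' -> ((rho x x')%:E < margin x)%E.

(* N_ML(V): minimal number of mutually-labeling sets covering V (+oo if none) *)
Definition N_ML (V : set X) : \bar R :=
  ereal_inf [set (n%:R)%:E | n in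
    [set n : nat | exists U : 'I_n -> set X,
        (forall i, mutually_labeling (U i)) /\ V `<=` \bigcup_(i in setT) U i]].

(* 1-NN mistake at time t (0-indexed stream h), worst case over tie-breaking;
   the first point (t = 0) has no neighbour and is counted as a mistake. *)
Definition nn_mistake (h : nat -> X) (t : nat) : Prop :=
  t = 0%N \/
  exists tau, (tau < t)%N /\
    (forall tau', (tau' < t)%N -> rho (h t) (h tau) <= rho (h t) (h tau')) /\
    c (h tau) <> c (h t).

Definition nn_mistakes (h : nat -> X) (T : nat) : R :=
  \sum_(t < T) (`[< nn_mistake h t >] : nat)%:R.

End Defs.

(* Main.v *)
(* A mutually labeling set contains at most one mistake, since after its first
   visit the nearest neighbour of a later visitor lies within its margin.
   Hence N_ML(V) plus the number of visits to V^c bounds the mistakes.  The law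
   of the process dominates the visits to A = V^c by independent Bernoulli(q)
   trials, q = eps(nu A), in the weak sense P(x_s in A for all s in J) <= q^|J|;
   expanding prod_s (1 + a 1_A(x_s)) over subsets J turns this into a bound on
   the moment generating function, hence into a Hoeffding tail
   P(visits >= Tq + lambda) <= exp(-lambda^2/T), which is (p/(2T))^2 for
   lambda = sqrt(2T log(2T/p)) and is summable over T.  The bound to be proved
   is deterministic and the number of mistakes is an integer, so a single
   near-optimal V per horizon T suffices. *)
Require Import Defs.
From HB Require Import structures.
From mathcomp Require Import all_boot all_order all_algebra.
From mathcomp Require Import all_classical all_reals all_analysis.
From mathcomp Require Import measurable_realfun lebesgue_measure.
From mathcomp Require Import ring lra.
Import Order.TTheory GRing.Theory Num.Theory.
Import numFieldNormedType.Exports.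
Local Open Scope classical_set_scope.
Local Open Scope ring_scope.

(** * Deterministic count of mistakes by cover pieces and outside visits *)

Lemma mutually_labeling_one_mistake (R : realType) (X Y : Type)
    (rho : X -> X -> R) (c : X -> Y) (U : set X) (h : nat -> X) (s t : nat) :
  mutually_labeling rho c U -> (s < t)%N -> U (h s) -> U (h t) ->
  ~ nn_mistake rho c h t.
Proof.
move=> mlU st Us Ut [t0|[tau [tau_t [tau_min tau_ne]]]]; first by rewrite t0 in st.
(* A wrong nearest neighbour [h tau] bounds the margin of [h t] by its distance, which is at most
   the distance to [h s]. *)
have := mlU _ _ Ut Us; rewrite ltNge => /negP; apply.
apply: (@le_trans _ _ (rho (h t) (h tau))%:E); last by rewrite lee_fin tau_min.
by apply: ereal_inf_lbound; exists (h tau).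
Qed.

Lemma nn_mistakes_le_cover_visits (R : realType) (X Y : Type)
    (rho : X -> X -> R) (c : X -> Y) (V : set X) (n : nat)
    (U : 'I_n -> set X) (h : nat -> X) (T : nat) :
  (forall i, mutually_labeling rho c (U i)) -> V `<=` \bigcup_i U i ->
  nn_mistakes rho c h T <= n%:R + \sum_(t < T) \1_(~` V) (h t).
Proof.
move=> mlU VU.
pose m t := `[< nn_mistake rho c h t >].
pose b (i : 'I_n) t := m t && `[< U i (h t) >].
(* A mistake at time [t] is charged to a piece containing [h t], or else to a visit outside [V]. *)
have mE (t : 'I_T) : (m t <= \sum_(i < n) b i t + (h t \in ~` V))%N.
  have [Vt|nVt] := pselect (V (h t)); last first.
    by rewrite mem_set// addn1 (leq_trans (leq_b1 _)).
  have [i _ Ui] := VU _ Vt.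
  by rewrite (bigD1 i)//= /b (asboolT Ui) andbT -!addnA leq_addr.
have b1 i : (\sum_(t < T) b i t <= 1)%N.
  have -> : (\sum_(t < T) b i t = #|[pred t : 'I_T | b i t]|)%N.
    by rewrite -sum1_card [RHS]big_mkcond/=; apply: eq_bigr => t _; rewrite inE; case: (b i t).
  apply/card_le1_eqP => s t; rewrite !inE => /andP[/asboolP ms /asboolP Us].
  move=> /andP[/asboolP mt /asboolP Ut]; apply: val_inj => /=.
  case: (ltngtP s t) => // st; exfalso.
  - exact: mutually_labeling_one_mistake (mlU i) st Us Ut mt.
  - exact: mutually_labeling_one_mistake (mlU i) st Ut Us ms.
rewrite /nn_mistakes -natr_sum.
under [X in _ + X]eq_bigr do rewrite indicE.
rewrite -natr_sum -natrD ler_nat.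
apply: leq_trans (leq_sum _ _) _; first by move=> t _; exact: mE.
rewrite big_split/= leq_add2r exchange_big/=.
apply: leq_trans (leq_sum _ _) _; first by move=> i _; exact: b1.
by rewrite sum1_card card_ord.
Qed.

(** * Exponential moments and tail bounds for visits *)

(** The constant 1/4, weaker than Hoeffding's 1/8, allows a first-order argument: the logarithmic
    gap [f] vanishes at 0 and has nonnegative derivative on the interval. *)
Lemma bernoulli_mgf_le (R : realType) (q s : R) : 0 <= q <= 1 -> 0 <= s ->
  1 + q * (expR s - 1) <= expR (s * q + s ^+ 2 / 4).
Proof.
move=> /andP[q0 q1] s0.
pose g (y : R) := 1 + q * (expR y - 1).
have g_gt0 y : 0 < g y by rewrite /g; have := expR_gt0 y; nra.
pose f (y : R) := y * q + y ^+ 2 / 4 - ln (g y).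
have fD (y : R) : is_derive y 1 f (q + y / 2 - q * expR y / g y).
  have gD : is_derive y 1 g (q * expR y).
    by rewrite /g; apply: is_derive_eq; rewrite /GRing.scale/=; ring.
  have lgD : is_derive y 1 (fun z => ln (g z)) ((g y)^-1 * (q * expR y)).
    exact: (is_derive1_comp (is_derive1_ln (g_gt0 y)) gD).
  rewrite /f; apply: is_derive_eq; rewrite /GRing.scale/=.
  by field; rewrite gt_eqF.
suff : f 0 <= f s.
  rewrite /f /g expR0 subrr mulr0 addr0 ln1 mul0r expr0n/= mul0r !subr0 addr0.
  by rewrite subr_ge0 -(@ler_expR _ (ln _)) lnK ?posrE//; exact: (g_gt0 s).
apply: (@ger0_derive1_ndecr _ f 0 s) => //.
- move=> y y01.
  have -> : (f^`())%classic y = q + y / 2 - q * expR y / g y by rewrite derive1E; apply: derive_val.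
  (* After clearing [g y], the claim is [q (1 - q) (expR y - 1) <= y / 2 * g y]. The half exponent
     factors [expR y - 1] as [(u - 1) (u + 1)]. *)
  pose u := expR (y / 2); have uE : expR y = u ^+ 2 by rewrite -expRM_natl; congr expR; lra.
  have u1 : 1 <= u by rewrite -expR0 ler_expR divr_ge0// (itvP y01).
  have y0 : 0 <= y by rewrite (itvP y01).
  have uy : u - 1 <= y / 2 * u.
    have := expR_ge1Dx (- (y / 2)); rewrite expRN -/u => h.
    have : (1 - y / 2) * u <= u^-1 * u by rewrite ler_wpM2r//; lra.
    by rewrite mulVf; lra.
  (* g y - q (1 - q) (u + 1)^2 is the square (1 - q (u + 1))^2 *)
  have qu : q * (1 - q) * (u + 1) ^+ 2 <= g y.
    have : 0 <= (1 - q * (u + 1)) ^+ 2 by exact: sqr_ge0.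
    by rewrite /g uE; nra.
  rewrite subr_ge0 ler_pdivrMr// uE.
  have h1 : q * (1 - q) * (u + 1) * (u - 1) <= q * (1 - q) * (u + 1) * (y / 2 * (u + 1)).
    by apply: ler_wpM2l; [rewrite !mulr_ge0//; lra | lra].
  have h2 : y / 2 * (q * (1 - q) * (u + 1) ^+ 2) <= y / 2 * g y by rewrite ler_wpM2l//; lra.
  by move: h1 h2; rewrite {2}/g /g uE; lra.
- apply: derivable_within_continuous => y _. exact: ex_derive.
Qed.

Lemma prod_indic_expand (R : comRingType) (Omega : Type) (T : nat)
    (A : 'I_T -> set Omega) (a : R) (w : Omega) :
  \prod_(i < T) (1 + a * \1_(A i) w) =
  \sum_(J : {set 'I_T}) a ^+ #|J| * \1_(\bigcap_(i in [set` J]) A i) w.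
Proof.
under eq_bigr do rewrite addrC.
rewrite (bigA_distr 1 +%R)/=; apply: eq_bigr => J _.
rewrite -big_mkcond/= big_split/= prodr_const; congr (_ * _).
have [JA|] := pselect ((\bigcap_(i in [set` J]) A i) w).
  rewrite indicE mem_set//; apply: big1 => i iJ; rewrite indicE mem_set//.
  exact: JA.
move=> nJA; rewrite indicE memNset//.
have [i iJ nAi] : exists2 i, i \in J & ~ A i w.
  apply: contrapT => nex; apply: nJA => i iJ.
  by apply: contrapT => nAi; apply: nex; exists i.
by rewrite (bigD1 i)//= indicE memNset// mul0r.
Qed.

(** Independence is replaced by bounds on intersections: for [s >= 0] the subset expansion of the
    exponential has nonnegative coefficients, so these bounds can be inserted term by term. *)
Lemma chernoff_visits (R : realType) (d : measure_display)
    (Omega : measurableType d) (P : probability Omega R) (T : nat)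
    (A : 'I_T -> set Omega) (q s m : R) :
  (forall i, measurable (A i)) -> 0 <= q -> 0 <= s ->
  (forall J : {set 'I_T}, (P (\bigcap_(i in [set` J]) A i) <= (q ^+ #|J|)%:E)%E) ->
  (P [set w | (m <= \sum_(i < T) \1_(A i) w)%R] <=
   (expR (- (s * m)) * (1 + q * (expR s - 1)) ^+ T)%:E)%E.
Proof.
move=> mA q0 s0 PA.
set D := [set w | _].
have mS : measurable_fun [set: Omega] (fun w => \sum_(i < T) \1_(A i) w : R).
  by apply: measurable_sum => i; exact: measurable_indic.
have mD : measurable D.
  rewrite [D](_ : _ = [set: Omega] `&` (fun w => \sum_(i < T) \1_(A i) w : R) @^-1` `[m, +oo[); last first.
    by rewrite setTI; apply/seteqP; split => w /=; rewrite in_itv/= andbT.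
  exact: mS.
pose a := expR s - 1.
have a0 : 0 <= a by rewrite subr_ge0 -expR0 ler_expR.
pose C (J : {set 'I_T}) := \bigcap_(i in [set` J]) A i.
have mC J : measurable (C J).
  by apply: fin_bigcap_measurable => // i _; exact: mA.
pose F w := (\sum_(J : {set 'I_T}) (a ^+ #|J|)%:E * (\1_(C J) w)%:E)%E.
have mF (J : {set 'I_T}) : measurable_fun setT (fun w => ((a ^+ #|J|)%:E * (\1_(C J) w)%:E)%E).
  under eq_fun do rewrite -EFinM.
  by apply/measurable_EFinP; apply: measurable_funM => //; exact: measurable_indic.
have F0 (J : {set 'I_T}) w : (0 <= (a ^+ #|J|)%:E * (\1_(C J) w)%:E :> \bar R)%E.
  by rewrite -EFinM lee_fin mulr_ge0// exprn_ge0.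
(* An indicator takes only the values 0 and 1, so [expR (s * \1_A)] equals [1 + a * \1_A]. *)
have FE w : F w = (expR (s * \sum_(i < T) \1_(A i) w))%:E.
  rewrite /F; under eq_bigr do rewrite -EFinM.
  rewrite sumEFin -prod_indic_expand mulr_sumr expR_sum; congr EFin.
  apply: eq_bigr => i _; rewrite indicE; case: (w \in A i) => /=.
    by rewrite !mulr1 /a addrC subrK.
  by rewrite !mulr0 addr0 expR0.
(* Markov's inequality for the exponential. *)
have DF : ((expR (s * m))%:E * P D <= \int[P]_w F w)%E.
  rewrite -[D]setIT -integral_indic// -ge0_integralZl_EFin//; last exact/measurable_EFinP/measurable_indic.
  apply: ge0_le_integral => //.
  - under eq_fun do rewrite -EFinM.
    by apply/measurable_EFinP; apply: measurable_funM => //; exact: measurable_indic.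
  - exact: emeasurable_sum.
  - move=> w _; rewrite FE -EFinM lee_fin indicE.
    have [Dw|_] := boolP (w \in D); last by rewrite mulr0 expR_ge0.
    by rewrite mulr1 ler_expR ler_wpM2l//; move: Dw; rewrite inE.
have intF : (\int[P]_w F w <= ((1 + q * a) ^+ T)%:E)%E.
  rewrite /F ge0_integral_sum//.
  (* The same subset expansion, with [q] in place of each indicator. *)
  have -> : (1 + q * a) ^+ T = \sum_(J : {set 'I_T}) a ^+ #|J| * q ^+ #|J|.
    rewrite -[in LHS](card_ord T) -prodr_const.
    under eq_bigl do rewrite inE.
    under eq_bigr do rewrite addrC.
    rewrite (bigA_distr 1 +%R)/=; apply: eq_bigr => J _.
    by rewrite -big_mkcond/= prodr_const mulrC exprMn.
  rewrite -sumEFin; apply: lee_sum => J _.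
  rewrite ge0_integralZl_EFin ?exprn_ge0//; last exact/measurable_EFinP/measurable_indic.
  by rewrite integral_indic// setIT EFinM lee_wpmul2l ?lee_fin ?exprn_ge0//; exact: PA.
have := le_trans DF intF.
rewrite muleC -lee_pdivlMr ?expR_gt0// => /le_trans; apply.
by rewrite -EFinM lee_fin expRN mulrC.
Qed.

(** Induction on time: at a selected time the conditional law contributes a factor at most [q]; at
    any other time the event is unchanged. Arbitrary [K] is allowed because the expansion ranges
    over all subsets of times. *)
Lemma law_visits_le (R : realType) (dX : measure_display)
    (X : measurableType dX) (mu : nat -> (nat -> X) -> probability X R)
    (dO : measure_display) (Omega : measurableType dO)
    (P : probability Omega R) (x : nat -> Omega -> X)
    (Hx_meas : forall t, measurable_fun setT (x t))
    (Hmu_meas : forall t A, measurable A ->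
      measurable_fun setT ((fun w => mu t (fun s => x s w) A) : Omega -> \bar R))
    (Hlaw : forall t (A : set X) (B : nat -> set X), measurable A ->
      (forall s, measurable (B s)) ->
      P [set w | (forall s, (s < t)%N -> B s (x s w)) /\ A (x t w)] =
      (\int[P]_(w in [set w | forall s, (s < t)%N -> B s (x s w)])
          mu t (fun s => x s w) A)%E)
    (A : set X) (q : R) :
  measurable A -> 0 <= q -> (forall t h, (mu t h A <= q%:E)%E) ->
  forall (K : pred nat) t,
    (P [set w | forall s, (s < t)%N -> K s -> A (x s w)] <=
     (q ^+ (\sum_(s < t) K s))%:E)%E.
Proof.
move=> mA q0 muA K; elim=> [|t IH].
  rewrite big_ord0 expr0 probability_le1//.
  rewrite (_ : [set _ | _] = setT) //; apply/seteqP; by split.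
(* Unselected times are constrained only by the whole space, which gives the past event the product
   form of [Hlaw]. *)
pose B s := if K s then A else setT.
have mB s : measurable (B s) by rewrite /B; case: ifP.
have BE : [set w | forall s, (s < t)%N -> K s -> A (x s w)] =
          [set w | forall s, (s < t)%N -> B s (x s w)].
  apply/seteqP; split=> w h s /h; rewrite /B; case: (K s) => //.
  by move=> /(_ isT).
rewrite big_ord_recr/=; case Kt : (K t); last first.
  rewrite addn0; move: IH; congr (_ <= _)%E; congr (P _).
  apply/seteqP; split=> w h s; last by move=> st; apply: h; rewrite ltnS ltnW.
  by rewrite ltnS leq_eqVlt => /orP[/eqP->|]; [rewrite Kt|exact: h].
have mD : measurable [set w | forall s, (s < t)%N -> B s (x s w)].
  rewrite (_ : [set _ | _] = \bigcap_(s in `I_t) (x s @^-1` B s)) //.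
  by apply: fin_bigcap_measurable => // s _; rewrite -[_ @^-1` _]setTI; exact: Hx_meas.
rewrite (_ : [set _ | _] =
  [set w | (forall s, (s < t)%N -> B s (x s w)) /\ A (x t w)]); last first.
  apply/seteqP; split=> w.
    move=> h; split; last exact: h.
    by move=> s st; rewrite /B; case: ifP => // Ks; apply: h; rewrite // ltnS ltnW.
  move=> [h At] s; rewrite ltnS leq_eqVlt => /orP[/eqP->//|/h].
  by rewrite /B => /[swap] ->.
rewrite Hlaw//; apply: (@le_trans _ _ (\int[P]_(w in
    [set w | forall s, (s < t)%N -> B s (x s w)]) cst q%:E w)%E).
  apply: ge0_le_integral => //.
  by apply: measurable_funS (Hmu_meas t A mA).
rewrite integral_cst// addn1 exprS EFinM -BE.
by rewrite lee_wpmul2l// lee_fin.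
Qed.

Lemma hoeffding_visits (R : realType) (d : measure_display)
    (Omega : measurableType d) (P : probability Omega R) (T : nat)
    (A : 'I_T -> set Omega) (q lambda : R) :
  (0 < T)%N -> (forall i, measurable (A i)) -> 0 <= q <= 1 -> 0 <= lambda ->
  (forall J : {set 'I_T}, (P (\bigcap_(i in [set` J]) A i) <= (q ^+ #|J|)%:E)%E) ->
  (P [set w | (T%:R * q + lambda <= \sum_(i < T) \1_(A i) w)%R] <=
   (expR (- (lambda ^+ 2 / T%:R)))%:E)%E.
Proof.
move=> T0 mA q01 l0 PA; have /andP[q0 q1] := q01.
have T0' : 0 < T%:R :> R by rewrite ltr0n.
(* This minimises [- s * lambda + T * s ^+ 2 / 4], with minimum [- lambda ^+ 2 / T]. *)
pose s := 2 * lambda / T%:R.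
have s0 : 0 <= s by rewrite divr_ge0 ?mulr_ge0// ltW.
apply: le_trans (@chernoff_visits _ _ _ _ _ _ _ s _ mA q0 s0 PA) _; rewrite lee_fin.
apply: (@le_trans _ _ (expR (- (s * (T%:R * q + lambda))) *
    expR (s * q + s ^+ 2 / 4) ^+ T)).
  rewrite ler_wpM2l ?expR_ge0// lerXn2r ?nnegrE ?expR_ge0 ?bernoulli_mgf_le//.
  by rewrite addr_ge0// mulr_ge0// subr_ge0 -expR0 ler_expR.
rewrite -expRM_natl -expRD ler_expR le_eqVlt; apply/orP; left; apply/eqP.
by rewrite /s; field; rewrite gt_eqF.
Qed.

Lemma law_visits_bigcap_le (R : realType) (dX : measure_display)
    (X : measurableType dX) (mu : nat -> (nat -> X) -> probability X R)
    (dO : measure_display) (Omega : measurableType dO)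
    (P : probability Omega R) (x : nat -> Omega -> X)
    (Hx_meas : forall t, measurable_fun setT (x t))
    (Hmu_meas : forall t A, measurable A ->
      measurable_fun setT ((fun w => mu t (fun s => x s w) A) : Omega -> \bar R))
    (Hlaw : forall t (A : set X) (B : nat -> set X), measurable A ->
      (forall s, measurable (B s)) ->
      P [set w | (forall s, (s < t)%N -> B s (x s w)) /\ A (x t w)] =
      (\int[P]_(w in [set w | forall s, (s < t)%N -> B s (x s w)])
          mu t (fun s => x s w) A)%E)
    (A : set X) (q : R) (T : nat) (J : {set 'I_T}) :
  measurable A -> 0 <= q -> (forall t h, (mu t h A <= q%:E)%E) ->
  (P (\bigcap_(i in [set` J]) (x i @^-1` A)) <= (q ^+ #|J|)%:E)%E.
Proof.
move=> mA q0 muA.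
pose K s := [exists i : 'I_T, (i == s :> nat) && (i \in J)].
have KE (i : 'I_T) : K i = (i \in J).
  apply/existsP/idP => [[j /andP[/eqP/val_inj->]]//|iJ].
  by exists i; rewrite eqxx.
have := @law_visits_le _ _ _ _ _ _ _ _ Hx_meas Hmu_meas Hlaw _ _ mA q0 muA K T.
rewrite (_ : (\sum_(s < T) K s)%N = #|J|); last first.
  by rewrite -sum1_card [RHS]big_mkcond/=; apply: eq_bigr => i _; rewrite KE; case: ifP.
congr (P _ <= _)%E; apply/seteqP; split=> w h.
  by move=> i iJ; apply: h => //; rewrite KE.
by move=> s sT /existsP[i /andP[/eqP<- iJ]]; exact: h.
Qed.

(** * Summing failure probabilities over horizons *)

Lemma sum_inv_sqr_le2 (R : realType) (n : nat) :
  \sum_(0 <= k < n) (k.+1%:R ^- 2) <= 2 :> R.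
Proof.
(* Strengthened for induction: with [y = n.+1], the new term is at most the telescoping difference
   [2 / y - 2 / (y + 1)]. *)
suff : \sum_(0 <= k < n) (k.+1%:R ^- 2) <= 2 - 2 / n.+1%:R :> R.
  by move=> /le_trans; apply; rewrite lerBlDr lerDl divr_ge0.
elim: n => [|n IH]; first by rewrite big_nil divr1 subrr.
rewrite big_nat_recr//=; apply: le_trans (lerD IH (lexx _)) _.
have y0 : 0 < n.+1%:R :> R by rewrite ltr0n.
have y1 : 1 <= n.+1%:R :> R by rewrite ler1n.
rewrite -[n.+2%:R]natr1; move: y0 y1; set y : R := n.+1%:R => y0 y1.
rewrite -subr_ge0 (_ : _ - _ = (y - 1) / (y ^+ 2 * (y + 1))); last first.
  by field; apply/andP; split; lra.
by rewrite divr_ge0 ?mulr_ge0 ?exprn_ge0//; lra.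
Qed.

Lemma union_bound_inv_sqr (R : realType) (d : measure_display)
    (Omega : measurableType d) (P : probability Omega R) (p : R)
    (F : nat -> set Omega) :
  0 <= p <= 1 -> (forall n, measurable (F n)) ->
  (forall n, (P (F n) <= ((p / (2 * n.+1%:R)) ^+ 2)%:E)%E) ->
  (P (\bigcup_n F n) <= p%:E)%E.
Proof.
move=> /andP[p0 p1] mF PF.
apply: le_trans (generalized_Boole_inequality P mF _) _; first exact: bigcup_measurable.
apply: lime_le; first exact: is_cvg_nneseries.
apply: nearW => n.
apply: (@le_trans _ _ (\sum_(0 <= k < n) (p ^+ 2 / 4 * k.+1%:R ^- 2))%:E).
  rewrite -sumEFin; apply: lee_sum => k _; apply: le_trans (PF k) _.
  rewrite lee_fin le_eqVlt; apply/orP; left; apply/eqP.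
  by field.
rewrite lee_fin -mulr_sumr; have := sum_inv_sqr_le2 R n.
have h : 0 <= p ^+ 2 / 4 by rewrite divr_ge0// sqr_ge0.
(* The total is at most [p ^+ 2 / 2], which is below [p] since [p <= 1]. *)
move=> /(ler_wpM2l h) /le_trans; apply; nra.
Qed.

(* An infimum need not be attained, but some element of [S] bounds the same
   integers as the infimum does. *)
Lemma nat_le_ereal_inf (R : realType) (S : set (\bar R)) :
  S !=set0 -> lbound S 0%E ->
  exists2 v, S v & forall k : nat, (k%:R%:E <= v)%E -> (k%:R%:E <= ereal_inf S)%E.
Proof.
move=> [v0 Sv0] S0.
have : (0 <= ereal_inf S)%E by exact/ereal_infP.
case infE : (ereal_inf S) => [r| |]//; last by exists v0 => // k _; rewrite leey.
rewrite lee_fin => r0.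
(* An integer at most [v] lies strictly below the truncation of [r] plus one, hence is at most
   [r]. *)
have [v Sv vr] : exists2 v, S v & (v < ((Num.truncn r).+1%:R)%:E)%E.
  by apply: ereal_inf_lt; rewrite infE lte_fin truncnS_gt.
exists v => // k kv; have := le_lt_trans kv vr.
by rewrite lte_fin ltr_nat ltnS truncn_ge_nat// lee_fin.
Qed.

Lemma N_ML_ge0 (R : realType) (X Y : Type) (rho : X -> X -> R) (c : X -> Y)
    (V : set X) : (0 <= N_ML rho c V)%E.
Proof. by apply/ereal_infP => _ [n _ <-]; rewrite lee_fin. Qed.

(** The near-optimal cover size is itself an integer, so it is among the integers it bounds and
    equals the infimum. *)
Lemma N_ML_attained (R : realType) (X Y : Type) (rho : X -> X -> R)
    (c : X -> Y) (V : set X) : (N_ML rho c V < +oo)%E ->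
  exists n (U : 'I_n -> set X), [/\ N_ML rho c V = n%:R%:E,
    forall i, mutually_labeling rho c (U i) & V `<=` \bigcup_i U i].
Proof.
move=> /ereal_inf_lt[v0 Sv0 _].
have [|_ [v [U [mlU VU]] <-] vP] := @nat_le_ereal_inf R _ (ex_intro _ v0 Sv0).
  by move=> _ [n _ <-]; rewrite lee_fin.
exists v, U; split => //; apply/eqP; rewrite eq_le vP// andbT.
by apply: ereal_inf_lbound; exists v => //; exists U.
Qed.

Lemma nn_mistakes_le (R : realType) (X Y : Type) (rho : X -> X -> R)
    (c : X -> Y) (h : nat -> X) (T : nat) : nn_mistakes rho c h T <= T%:R.
Proof.
rewrite /nn_mistakes -natr_sum ler_nat.
by rewrite -[leqRHS]card_ord -sum1_card; apply: leq_sum => t _; exact: leq_b1.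
Qed.

(** * The simultaneous high-probability bound *)

Theorem theorem7
  (R : realType)
  (* metric measure space (X, rho, nu), Borel sigma-algebra, rho separable *)
  (dX : measure_display) (X : measurableType dX) (rho : X -> X -> R)
  (Hmetric : is_metric rho)
  (Hsep : rho_separable rho)
  (Hborel : @measurable dX X = <<s rho_open rho >>)
  (nu : {measure set X -> \bar R})
  (Hnufin : (nu setT < +oo)%E)
  (* concept with nu-null boundary *)
  (Y : Type) (c : X -> Y)
  (Hbd : nu.-negligible (boundary rho c))
  (* smoothness rate, nu-dominated *)
  (eps : R -> R)
  (Heps01 : forall d, 0 <= d -> 0 <= eps d <= 1)
  (Hepslim : eps x @[x --> 0^'+] --> 0)
  (* adaptive adversary: mu t h is the distribution of x_t given history h
     (depends only on h s for s < t) *)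
  (mu : nat -> (nat -> X) -> probability X R)
  (Hmu_hist : forall t h h', (forall s, (s < t)%N -> h s = h' s) -> mu t h = mu t h')
  (Hmu_smooth : forall t h A, measurable A -> (mu t h A <= (eps (fine (nu A)))%:E)%E)
  (* the random process x_0, x_1, ... on a probability space *)
  (dO : measure_display) (Omega : measurableType dO) (P : probability Omega R)
  (x : nat -> Omega -> X)
  (Hx_meas : forall t, measurable_fun setT (x t))
  (Hmu_meas : forall t A, measurable A ->
      measurable_fun setT ((fun w => mu t (fun s => x s w) A) : Omega -> \bar R))
  (Hlaw : forall t (A : set X) (B : nat -> set X), measurable A ->
      (forall s, measurable (B s)) ->
      P [set w | (forall s, (s < t)%N -> B s (x s w)) /\ A (x t w)] =
      (\int[P]_(w in [set w | forall s, (s < t)%N -> B s (x s w)])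
          mu t (fun s => x s w) A)%E)
  (p : R) (Hp : 0 < p) :
  exists E : set Omega, measurable E /\ (P E >= (1 - p)%:E)%E /\
    forall w, E w -> forall T : nat,
      ((nn_mistakes rho c (fun s => x s w) T)%:E <=
       Order.min (T%:R)%:E
         (ereal_inf [set (N_ML rho c V
                          + (T%:R * eps (fine (nu (~` V))))%:E
                          + (Num.sqrt (2 * T%:R * ln (2 * T%:R / p)))%:E)%E
                     | V in [set V : set X | measurable V]]))%E.
Proof.
(* For [p >= 1] the required probability is nonpositive, so the empty event suffices. *)
have [p1|p1] := leP 1 p.
  exists set0; split=> //; split=> //.
  by rewrite measure0 lee_fin subr_le0.
pose bound T V := (N_ML rho c V + (T%:R * eps (fine (nu (~` V))))%:E
  + (Num.sqrt (2 * T%:R * ln (2 * T%:R / p)))%:E)%E.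
have bound_ge0 T V : (0 <= bound T V)%E.
  rewrite !adde_ge0 ?N_ML_ge0// lee_fin ?sqrtr_ge0// mulr_ge0//.
  by case/andP: (Heps01 _ (fine_ge0 (measure_ge0 nu (~` V)))).
(* One failure event per positive horizon [n.+1]; its set [V] is fixed before the sample point
   [w]. *)
have bad n : exists F : set Omega, [/\ measurable F,
    (P F <= ((p / (2 * n.+1%:R)) ^+ 2)%:E)%E &
    forall w, ~ F w -> ((nn_mistakes rho c (fun s => x s w) n.+1)%:E <=
      ereal_inf [set bound n.+1 V | V in [set V | measurable V]])%E].
  have [||_ [V mV <-] VP] :=
      @nat_le_ereal_inf R [set bound n.+1 V | V in [set V | measurable V]].
  - by exists (bound n.+1 setT); exists setT => //; exact: measurableT.
  - by move=> _ [V _ <-].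
  set T := n.+1 in VP *.
  set q := eps (fine (nu (~` V))).
  pose y := 2 * T%:R / p; pose lambda := Num.sqrt (2 * T%:R * ln y).
  have T0 : 0 < T%:R :> R by rewrite ltr0n.
  have T1 : 1 <= T%:R :> R by rewrite ler1n.
  (* This makes the logarithm nonnegative, so that [lambda ^+ 2] recovers the radicand and the tail
     becomes [y ^- 2]. *)
  have y1 : 1 <= y by rewrite ler_pdivlMr//; lra.
  have q01 : 0 <= q <= 1 by exact/Heps01/fine_ge0/measure_ge0.
  have /andP[q0 q1] := q01.
  have mA : measurable (~` V) by exact: measurableC.
  have mxA (i : 'I_T) : measurable (x i @^-1` (~` V)).
    by rewrite -[_ @^-1` _]setTI; exact: Hx_meas.
  exists [set w | (T%:R * q + lambda <= \sum_(i < T) \1_(x i @^-1` (~` V)) w)%R].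
  split.
  - rewrite -[X in measurable X]setTI.
    rewrite (_ : [set w | _] = (fun w => \sum_(i < T) \1_(x i @^-1` (~` V)) w : R)
        @^-1` `[T%:R * q + lambda, +oo[); last first.
      by apply/seteqP; split=> w /=; rewrite in_itv/= andbT.
    suff : measurable_fun setT
        (fun w => \sum_(i < T) \1_(x i @^-1` (~` V)) w : R) by exact.
    by apply: measurable_sum => i; exact: measurable_indic.
  - apply: le_trans (@hoeffding_visits _ _ _ _ T _ _ lambda _ mxA q01 _ _) _ => //.
    + exact: sqrtr_ge0.
    + move=> J; apply: (@law_visits_bigcap_le _ _ _ _ _ _ _ _ Hx_meas Hmu_meas Hlaw _ _ _ _ mA q0).
      by move=> t h; exact: Hmu_smooth.
    + rewrite lee_fin sqr_sqrtr ?mulr_ge0 ?ln_ge0//.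
      rewrite (_ : 2 * T%:R * ln y / T%:R = 2%:R * ln y); last first.
        by field; rewrite gt_eqF.
      rewrite expRN expRM_natl lnK ?posrE; last exact: lt_le_trans y1.
      rewrite -exprVn /y invf_div; exact: lexx.
  - move=> w /negP; rewrite -ltNge => visits.
    (* Exhibits the mistake count as a natural number, as [VP] demands. *)
    have -> : nn_mistakes rho c (fun s => x s w) T =
        (\sum_(t < T) `[< nn_mistake rho c (fun s => x s w) t >])%:R.
      by rewrite natr_sum.
    apply: VP; rewrite natr_sum -/(nn_mistakes rho c (fun s => x s w) T) /bound.
    have [Noo|/N_ML_attained[m [U [-> mlU VU]]]] := leP +oo%E (N_ML rho c V).
      by move: Noo; rewrite leye_eq => /eqP->; rewrite !addye// leey.
    rewrite -!EFinD lee_fin.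
    apply: le_trans (@nn_mistakes_le_cover_visits _ _ _ _ _ _ _ _ _ _ mlU VU) _.
    by rewrite -addrA lerD2l ltW.
have [F FP] := choice bad.
have mF n : measurable (F n) by case: (FP n).
have mU : measurable (\bigcup_n F n) by exact: bigcup_measurable.
exists (~` \bigcup_n F n); split; first exact: measurableC.
split.
  rewrite probability_setC// EFinB leeB//.
  apply: union_bound_inv_sqr => //; first by rewrite !ltW.
  by move=> n; case: (FP n).
move=> w nFw T; rewrite le_min lee_fin nn_mistakes_le/=.
(* Horizon 0 has no failure event: its count is an empty sum and its bound is nonnegative. *)
case: T => [|n]; last by case: (FP n) => _ _; apply=> Fw; apply: nFw; exists n.
rewrite /nn_mistakes big_ord0; apply/ereal_infP => _ [V _ <-].
exact: bound_ge0.
Qed.
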